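(* Let $G$ and $H$ be graphs with $\mathrm{oh}(G)=s\geq 2$ and $\mathrm{oh}(H)=t\geq 2$. If $\ast$ is either the lexicographic product or the strong product $\boxtimes$, then $\mathrm{oh}(G\ast H)\geq st$.
   Context: All graphs are finite, simple and loopless. $\mathrm{oh}(G)$ (Odd Hadwiger number) is the largest integer $m$ for which there exist $m$ pairwise vertex-disjoint trees $Z_1,\dots,Z_m$ in $G$ and a 2-colouring $c$ of $V(Z_1)\cup\dots\cup V(Z_m)$ that is proper on each $Z_k$, such that for every $k\neq k'$ there is an edge $xy\in E(G)$ with $x\in V(Z_k)$, $y\in V(Z_{k'})$, $c(x)=c(y)$. Both products have vertex set $V(G)\times V(H)$. Lexicographic product: $(v_1,u_1)\sim(v_2,u_2)$ iff $v_1v_2\in E(G)$, or ($v_1=v_2$ and $u_1u_2\in E(H)$). Strong product: $(v_1,u_1)\sim(v_2,u_2)$ iff ($v_1=v_2$ and $u_1u_2\in E(H)$), or ($u_1=u_2$ and $v_1v_2\in E(G)$), or ($v_1v_2\in E(G)$ and $u_1u_2\in E(H)$). *)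

(* Defs.v *)
From mathcomp Require Import all_boot.
From mathcomp Require Import boolp.

Set Implicit Arguments.
Unset Strict Implicit.
Unset Printing Implicit Defensive.

Record sgraph := SGraph {
  vertex :> finType;
  adj : rel vertex;
  adj_sym : symmetric adj;
  adj_irrefl : irreflexive adj }.

(* Subgraphs need not be induced: the edge relation is part of the data. *)
Record subgraph (G : sgraph) := Subgraph {
  sub_vertices : {set G};
  sub_adj : rel G;
  sub_adj_sym : symmetric sub_adj;
  sub_adjP : forall x y, sub_adj x y ->
    [/\ x \in sub_vertices, y \in sub_vertices & adj x y] }.

Definition connected (G : sgraph) (Z : subgraph G) : Prop :=
  sub_vertices Z != set0 /\
  {in sub_vertices Z &, forall x y, connect (@sub_adj _ Z) x y}.

(* For a symmetric relation, an edge traversed back and forth is a [ucycle]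
   of size 2; graph cycles are those of size at least 3. *)
Definition acyclic (G : sgraph) (Z : subgraph G) : Prop :=
  forall p : seq G, ucycle (@sub_adj _ Z) p -> size p <= 2.

Definition is_tree (G : sgraph) (Z : subgraph G) : Prop :=
  connected Z /\ acyclic Z.

(* The colouring is total on G; only its values on the trees are ever used. *)
Definition odd_clique_model (G : sgraph) (m : nat)
    (Z : 'I_m -> subgraph G) (c : G -> bool) : Prop :=
  [/\ forall k, is_tree (Z k),
      forall k k', k != k' ->
        [disjoint sub_vertices (Z k) & sub_vertices (Z k')],
      forall k x y, sub_adj (Z k) x y -> c x != c y
    & forall k k', k != k' -> exists x y,
        [/\ x \in sub_vertices (Z k), y \in sub_vertices (Z k'),
            adj x y & c x = c y]].

Definition has_odd_clique_model (G : sgraph) (m : nat) : Prop :=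
  exists (Z : 'I_m -> subgraph G) (c : G -> bool), odd_clique_model Z c.

Lemma has_odd_clique_model0 (G : sgraph) :
  exists m, `[< has_odd_clique_model G m >].
Proof.
exists 0; apply/asboolP.
have Z : 'I_0 -> subgraph G by case.
by exists Z, (fun=> false); split; case.
Qed.

Lemma has_odd_clique_model_bound (G : sgraph) (m : nat) :
  `[< has_odd_clique_model G m >] -> m <= #|G|.
Proof.
case/asboolP=> Z [c [treeZ disjZ _ _]].
have neZ k : exists x, x \in sub_vertices (Z k).
  by case: (treeZ k) => -[/set0Pn].
pose f k := xchoose (neZ k).
have fZ k : f k \in sub_vertices (Z k) by apply: xchooseP.
rewrite -[m]card_ord; apply: (@leq_card _ _ f) => k k' eq_f.
apply: contraTeq (fZ k') => /disjZ /disjointFr disjk.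
by rewrite disjk // -eq_f.
Qed.

(* The odd Hadwiger number: the largest m admitting such a model. *)
Definition oh (G : sgraph) : nat :=
  ex_maxn (has_odd_clique_model0 G) (@has_odd_clique_model_bound G).

Lemma ohP (G : sgraph) :
  has_odd_clique_model G (oh G) /\
  forall m, has_odd_clique_model G m -> m <= oh G.
Proof.
rewrite /oh; case: ex_maxnP => n /asboolP modn maxn; split=> // m modm.
by apply: maxn; apply/asboolP.
Qed.

Definition lex_adj (G H : sgraph) : rel (G * H) := fun p q =>
  adj p.1 q.1 || ((p.1 == q.1) && adj p.2 q.2).

Lemma lex_adj_sym (G H : sgraph) : symmetric (@lex_adj G H).
Proof.
by move=> p q; rewrite /lex_adj adj_sym eq_sym (adj_sym p.2).
Qed.

Lemma lex_adj_irrefl (G H : sgraph) : irreflexive (@lex_adj G H).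
Proof. by move=> p; rewrite /lex_adj !adj_irrefl andbF. Qed.

Definition lex_product (G H : sgraph) : sgraph :=
  SGraph (@lex_adj_sym G H) (@lex_adj_irrefl G H).

Definition strong_adj (G H : sgraph) : rel (G * H) := fun p q =>
  [|| (p.1 == q.1) && adj p.2 q.2,
      (p.2 == q.2) && adj p.1 q.1
    | adj p.1 q.1 && adj p.2 q.2].

Lemma strong_adj_sym (G H : sgraph) : symmetric (@strong_adj G H).
Proof.
move=> p q; rewrite /strong_adj (eq_sym p.1) (eq_sym p.2).
by rewrite (adj_sym p.1) (adj_sym p.2).
Qed.

Lemma strong_adj_irrefl (G H : sgraph) : irreflexive (@strong_adj G H).
Proof. by move=> p; rewrite /strong_adj !adj_irrefl !andbF. Qed.

Definition strong_product (G H : sgraph) : sgraph :=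
  SGraph (@strong_adj_sym G H) (@strong_adj_irrefl G H).

(* Main.v *)
Require Import Defs.
From mathcomp Require Import all_boot.
From mathcomp Require Import boolp.

Set Implicit Arguments.
Unset Strict Implicit.
Unset Printing Implicit Defensive.

(** If [c] and [d] are the colourings of models [Z] of [G] and [Y] of [H],
    colour [G * H] by [c x (+) d y].  Every edge of the Cartesian product of
    [Z i] and [Y j] is then bichromatic, so the block [Z i * Y j] contains a
    properly coloured spanning tree; and a pair of monochromatic edges, one of
    [G] and one of [H], yields a monochromatic edge between any two distinct
    blocks.  All the edges involved belong to the strong product, which is a
    spanning subgraph of the lexicographic product. *)

Lemma homo_connect (T T' : finType) (e : rel T) (e' : rel T') (f : T -> T') :
  {homo f : x y / e x y >-> e' x y} ->
  {homo f : x y / connect e x y >-> connect e' x y}.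
Proof.
move=> f_homo x _ /connectP[p e_p ->]; apply/connectP.
by exists (map f p); [apply: homo_path e_p | rewrite last_map].
Qed.

Definition del_edge (T : eqType) (r : rel T) (x y : T) : rel T := fun u v =>
  [&& r u v, (u, v) != (x, y) & (u, v) != (y, x)].

Lemma del_edge_sym (T : eqType) (r : rel T) (x y : T) :
  symmetric r -> symmetric (del_edge r x y).
Proof.
move=> r_sym u v; rewrite /del_edge r_sym !xpair_eqE.
by rewrite [(v == x) && _]andbC [(v == y) && _]andbC [X in _ && X]andbC.
Qed.

(** The deleted edge closes the cycle, so the path from [x] through [q] is a detour around it. With
    [size q = 1] that path would be the deleted edge itself, hence the bound. *)
Lemma connect_del_edge (T : finType) (r : rel T) (x : T) (q : seq T) :
  symmetric r -> ucycle r (x :: q) -> 1 < size q ->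
  connect (del_edge r x (last x q)) =2 connect r.
Proof.
move=> r_sym; case: q => [|a [|b q]] // /andP[cyc_r uq] _.
set y := last x _; set r' := del_edge r x y.
have r'C : connect_sym r' by apply/sym_connect_sym/del_edge_sym.
have y_q : y \in b :: q by apply: (mem_last b q).
have r'xy : connect r' x y.
  move: cyc_r uq; rewrite (cycle_path x) /= => /and3P[_ rxa].
  move=> /andP[rab rbq] /andP[xq /andP[aq _]].
  have xaq : all (predC1 x) [:: a, b & q].
    by apply/allP => z zq /=; apply: contraNneq xq => <-.
  apply/connectP; exists [:: a, b & q] => //.
  (* By uniqueness, the first step from [x] to [a] survives because [a] differs from [y], which lies
     in [b :: q]. All later steps survive because they avoid [x]. *)
  rewrite [path _ _ _]/= -/(path r' a (b :: q)); apply/andP; split.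
    rewrite /r' /del_edge rxa !xpair_eqE eqxx /=.
    have /= := allP xaq a (mem_head _ _) => /negbTE ->.
    by rewrite andbF andbT; apply: contraNneq aq => ->.
  apply: (@sub_in_path _ _ r) xaq _; last by rewrite /= rab.
  move=> u v /= u_x v_x ruv; rewrite /r' /del_edge ruv !xpair_eqE.
  by rewrite (negbTE u_x) (negbTE v_x) andbF.
move=> u v; apply/idP/idP; apply: connect_sub => {u v} u v.
  by case/and3P => ruv _ _; apply: connect1.
move=> ruv; have [[-> ->] // | uv_xy] := eqVneq (u, v) (x, y).
have [[-> ->] | uv_yx] := eqVneq (u, v) (y, x); first by rewrite r'C.
by apply: connect1; rewrite /r' /del_edge ruv uv_xy.
Qed.

(** Induction on the number of related ordered pairs: while some cycle has length at least 3, delete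
    its closing edge, which preserves connectivity. *)
Lemma spanning_forest (T : finType) (r : rel T) :
  symmetric r ->
  exists r' : rel T, [/\ symmetric r', subrel r' r, connect r' =2 connect r
    & forall p, ucycle r' p -> size p <= 2].
Proof.
have [n] := ubnP #|[set e | r e.1 e.2]|.
elim: n r => // n IHn r r_lt r_sym.
have [acyc | /existsPNP[p cyc_p]] := EM (forall p, ucycle r p -> size p <= 2).
  by exists r; split.
move/negP; rewrite -ltnNge; case: p cyc_p => //= x q cyc_q q_gt1.
have del_r := connect_del_edge r_sym cyc_q q_gt1.
set r1 := del_edge r x _ in del_r.
have [|| r' [r'_sym r'_sub r'_con acyc]] := IHn r1.
- rewrite -ltnS (leq_trans _ r_lt) // ltnS; apply/proper_card/properP; split.
    by apply/subsetP => e; rewrite !inE => /and3P[].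
  (* The closing edge of the cycle witnesses that the set of pairs strictly shrinks. *)
  exists (last x q, x); rewrite !inE /=; last by rewrite /r1 /del_edge eqxx !andbF.
  case/andP: cyc_q => + _; rewrite (cycle_path x).
  by case/lastP: q q_gt1 {r1 del_r} => //= q z _; rewrite last_rcons => /andP[].
- exact: del_edge_sym.
exists r'; split=> // [u v /r'_sub /and3P[] // | u v].
by rewrite r'_con del_r.
Qed.

(** This reduces trees to connected bichromatic relations: a spanning forest of a connected block is
    a tree, and it inherits the proper colouring as a subrelation. Allowing any finite index type
    lets pairs of indices serve directly. *)
Lemma has_odd_clique_model_blocks (G : sgraph) (I : finType)
    (A : I -> {set G}) (r : I -> rel G) (c : G -> bool) :
  (forall k, A k != set0) ->
  (forall k, symmetric (r k)) ->
  (forall k x y, r k x y ->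
    [/\ x \in A k, y \in A k, adj x y & c x != c y]) ->
  (forall k, {in A k &, forall x y, connect (r k) x y}) ->
  (forall k k', k != k' -> [disjoint A k & A k']) ->
  (forall k k', k != k' -> exists x y,
    [/\ x \in A k, y \in A k', adj x y & c x = c y]) ->
  has_odd_clique_model G #|I|.
Proof.
move=> A_n0 r_sym rP r_con A_disj A_mono.
have treeP k : exists Z : subgraph G,
    [/\ sub_vertices Z = A k, is_tree Z & subrel (sub_adj Z) (r k)].
  have [r' [r'_sym r'_sub r'_con acyc]] := spanning_forest (r_sym k).
  have r'P x y : r' x y -> [/\ x \in A k, y \in A k & adj x y].
    by move/r'_sub/rP => [].
  exists (Subgraph r'_sym r'P); split=> //; split=> //; split=> //= x y xA yA.
  by rewrite r'_con r_con.
have [Z ZP] := choice treeP.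
have neq_val (k k' : 'I_#|I|) : k != k' -> enum_val k != enum_val k'.
  by apply: contra_neq => /enum_val_inj.
exists (fun k => Z (enum_val k)), c; split=> [k | k k' | k x y | k k'].
- by have [] := ZP (enum_val k).
- by move/neq_val/A_disj; have [-> _ _] := ZP (enum_val k);
     have [-> _ _] := ZP (enum_val k').
- by have [_ _ Zr] := ZP (enum_val k) => /Zr/rP[].
- by move/neq_val/A_mono; have [-> _ _] := ZP (enum_val k);
     have [-> _ _] := ZP (enum_val k').
Qed.

Lemma odd_clique_model_mono (G : sgraph) (m : nat) (Z : 'I_m -> subgraph G)
    (c : G -> bool) (i i' : 'I_m) :
  odd_clique_model Z c -> exists x x',
    [/\ x \in sub_vertices (Z i), x' \in sub_vertices (Z i'), c x = c x'
      & if i == i' then x = x' else adj x x'].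
Proof.
case=> treeZ _ _ monoZ; have [<- | /monoZ[x [x' []]]] := eqVneq; last first.
  by exists x, x'.
by have [[/set0Pn[x Zx] _] _] := treeZ i; exists x, x.
Qed.

Section CartesianBlock.

Variables (G H : sgraph) (X : subgraph G) (Y : subgraph H).

(** The Cartesian product of [X] and [Y], as a relation on all of [G * H]; the membership tests on
    the constant coordinate confine its edges to the block. *)
Definition block_adj : rel (G * H) := fun p q =>
  [&& sub_adj X p.1 q.1, p.2 == q.2 & p.2 \in sub_vertices Y] ||
  [&& sub_adj Y p.2 q.2, p.1 == q.1 & p.1 \in sub_vertices X].

Lemma block_adj_sym : symmetric block_adj.
Proof.
move=> [x y] [x' y']; rewrite /block_adj /= (sub_adj_sym X) (sub_adj_sym Y).
by rewrite (eq_sym x) (eq_sym y); do 2?case: eqVneq => [->|_].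
Qed.

Lemma block_adj_connect :
  connected X -> connected Y ->
  {in setX (sub_vertices X) (sub_vertices Y) &, forall p q,
    connect block_adj p q}.
Proof.
move=> [_ X_con] [_ Y_con] [x y] [x' y'].
rewrite !inE /= => /andP[Xx Yy] /andP[Xx' Yy'].
(* Walk along [X] at height [y], then along [Y] above [x']. *)
apply: (@connect_trans _ _ (x', y)).
  apply: (@homo_connect _ _ _ _ (pair^~ y)) (X_con x x' Xx Xx') => u v uv.
  by rewrite /block_adj /= uv eqxx Yy.
apply: homo_connect (Y_con y y' Yy Yy') => u v uv.
by rewrite /block_adj /= uv eqxx Xx' orbT.
Qed.

End CartesianBlock.

Lemma has_odd_clique_model_strong (G H : sgraph) (s t : nat) :
  has_odd_clique_model G s -> has_odd_clique_model H t ->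
  has_odd_clique_model (strong_product G H) (s * t).
Proof.
move=> [Z [c modZ]] [Y [d modY]].
have [treeZ disjZ properZ _] := modZ; have [treeY disjY properY _] := modY.
rewrite -[s]card_ord -[t in _ * t]card_ord -card_prod.
apply: (@has_odd_clique_model_blocks (strong_product G H) _
  (fun k => setX (sub_vertices (Z k.1)) (sub_vertices (Y k.2)))
  (fun k => block_adj (Z k.1) (Y k.2)) (fun p => c p.1 (+) d p.2)).
- move=> [i j] /=; have [[/set0Pn[x Zx] _] _] := treeZ i.
  have [[/set0Pn[y Yy] _] _] := treeY j.
  by apply/set0Pn; exists (x, y); rewrite inE Zx.
- by move=> k; apply: block_adj_sym.
- move=> [i j] [x y] [x' y']; rewrite /block_adj /= !inE /strong_adj /=.
  case/orP=> /and3P[/[dup] uv /sub_adjP[-> -> adj_uv] /eqP <- ->].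
    by rewrite eqxx adj_uv orbT (inj_eq (@addIb _)) (properZ _ _ _ uv).
  by rewrite eqxx adj_uv (inj_eq (@addbI _)) (properY _ _ _ uv).
- move=> [i j]; apply: block_adj_connect.
    by have [] := treeZ i.
  by have [] := treeY j.
- move=> [i j] [i' j']; rewrite xpair_eqE negb_and => neq.
  apply/pred0P => -[x y]; rewrite /= !inE /=; apply/negP.
  case/andP=> /andP[Zx Yy] /andP[Zx' Yy']; case/orP: neq.
    by move/disjZ/disjointFr/(_ Zx); rewrite Zx'.
  by move/disjY/disjointFr/(_ Yy); rewrite Yy'.
move=> [i j] [i' j']; rewrite xpair_eqE.
have [x [x' [Zx Zx' cx xx']]] := odd_clique_model_mono i i' modZ.
have [y [y' [Yy Yy' dy yy']]] := odd_clique_model_mono j j' modY.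
move=> neq; exists (x, y), (x', y'); rewrite !inE /= Zx Yy cx dy; split=> //.
  exact/andP.
(* If one index is shared, that coordinate is constant and the other one moves along an edge; if
   both differ, both coordinates move, which is the diagonal clause of the strong product. *)
rewrite /strong_adj /=; move: neq xx' yy'.
by case: eqP => _; case: eqP => _ //= _ -> ->; rewrite ?eqxx ?orbT.
Qed.

(** Both products have the same vertices and every strong edge is lexicographic, so the same trees
    and colouring serve; only the proof that tree edges are graph edges is rebuilt. *)
Lemma has_odd_clique_model_lex (G H : sgraph) (m : nat) :
  has_odd_clique_model (strong_product G H) m ->
  has_odd_clique_model (lex_product G H) m.
Proof.
have strong_lex (p q : G * H) : strong_adj p q -> lex_adj p q.
  by rewrite /lex_adj => /or3P[-> | /andP[_ ->] | /andP[-> _]]; rewrite ?orbT.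
case=> Z [c [treeZ disjZ properZ monoZ]].
have subP k x y : sub_adj (Z k) x y ->
    [/\ x \in sub_vertices (Z k), y \in sub_vertices (Z k) & lex_adj x y].
  by case/sub_adjP => ? ? /strong_lex.
exists (fun k => @Subgraph (lex_product G H) _ _ (sub_adj_sym (Z k)) (@subP k)).
exists c; split=> // k k' /monoZ[x [y [? ? /strong_lex xy ?]]].
by exists x, y.
Qed.

Theorem theorem3 (G H : sgraph) (s t : nat)
  (ohG : oh G = s) (s_ge2 : 2 <= s) (ohH : oh H = t) (t_ge2 : 2 <= t) :
  s * t <= oh (lex_product G H) /\ s * t <= oh (strong_product G H).
Proof.
have [modG _] := ohP G; have [modH _] := ohP H.
have mod_strong := has_odd_clique_model_strong modG modH.
rewrite -ohG -ohH; split; apply: (ohP _).2 => //.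
exact: has_odd_clique_model_lex.
Qed.
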